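(* Let $R$ be a Cohen-Macaulay local ring of dimension $d$, and let $M,N$ be finitely generated $R$-modules with $N$ maximal Cohen-Macaulay. Suppose that: (i) $\operatorname{Ext}^i_R(M,N)=0$ for all $i=1,\dots,d$ if $d\ge1$, or for all $i>0$ if $d=0$; (ii) $\operatorname{Ext}^j_R(\operatorname{Tr}M,\operatorname{Hom}_R(M,N))=0$ for all $j=1,\dots,d+1$. Then $M$ is free.
   Context: All rings are commutative, unital and Noetherian. A maximal Cohen-Macaulay module is a nonzero finitely generated module whose depth equals $\dim R$. The (Auslander) transpose $\operatorname{Tr}M$ of a finitely generated module $M$ over a local ring $R$ is the cokernel of the dual map $F^*\to G^*$, where $G\to F\to M\to0$ is a minimal free presentation and $(-)^*=\operatorname{Hom}_R(-,R)$; it is unique up to isomorphism. *)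

(* Defs.v *)
From HB Require Import structures.
From mathcomp Require Import all_boot all_algebra.
From mathcomp Require Import boolp.
From mathcomp Require Export freeg.

Set Implicit Arguments.
Unset Strict Implicit.
Unset Printing Implicit Defensive.

Import GRing.Theory.
Local Open Scope ring_scope.
Local Open Scope quotient_scope.

(* [{linear M -> N}] with its pointwise operations is the module Hom_R(M, N).
   Equality and choice on linear maps are classical. *)
Section Hom.
Variables (R : comNzRingType) (M N : lmodType R).

HB.instance Definition _ := gen_eqMixin {linear M -> N}.
HB.instance Definition _ := gen_choiceMixin {linear M -> N}.

Lemma linear_ext (f g : {linear M -> N}) : f =1 g -> f = g.
Proof.
case: f g => [f [[Af] [Sf]]] [g [[Ag] [Sg]]] /= /funext E.
move: Af Sf Ag Sg; rewrite {}E => Af Sf Ag Sg.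
by rewrite (Prop_irrelevance Af Ag) (Prop_irrelevance Sf Sg).
Qed.

Definition hom_zero : {linear M -> N} := \0.
Definition hom_opp (f : {linear M -> N}) : {linear M -> N} := \- f.
Definition hom_add (f g : {linear M -> N}) : {linear M -> N} := f \+ g.
Definition hom_scale (a : R) (f : {linear M -> N}) : {linear M -> N} := a \*: f.

Fact hom_addA : associative hom_add.
Proof. by move=> f g h; apply: linear_ext => x /=; rewrite addrA. Qed.
Fact hom_addC : commutative hom_add.
Proof. by move=> f g; apply: linear_ext => x /=; rewrite addrC. Qed.
Fact hom_add0 : left_id hom_zero hom_add.
Proof. by move=> f; apply: linear_ext => x /=; rewrite add0r. Qed.
Fact hom_addN : left_inverse hom_zero hom_opp hom_add.
Proof. by move=> f; apply: linear_ext => x /=; rewrite addNr. Qed.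
HB.instance Definition _ :=
  GRing.isZmodule.Build {linear M -> N} hom_addA hom_addC hom_add0 hom_addN.

Fact hom_scaleA a b f : hom_scale a (hom_scale b f) = hom_scale (a * b) f.
Proof. by apply: linear_ext => x /=; rewrite scalerA. Qed.
Fact hom_scale1 : left_id 1 hom_scale.
Proof. by move=> f; apply: linear_ext => x /=; rewrite scale1r. Qed.
Fact hom_scaleDr : right_distributive hom_scale +%R.
Proof. by move=> a f g; apply: linear_ext => x /=; rewrite scalerDr. Qed.
Fact hom_scaleDl f : {morph hom_scale^~ f : a b / a + b}.
Proof. by move=> a b; apply: linear_ext => x /=; rewrite scalerDl. Qed.
HB.instance Definition _ := GRing.Zmodule_isLmodule.Build R {linear M -> N}
  hom_scaleA hom_scale1 hom_scaleDr hom_scaleDl.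

Definition HomR : lmodType R := {linear M -> N}.

End Hom.

(* The map Hom_R(B, N) -> Hom_R(A, N) induced by [u : A -> B]; for [N = R^o]
   it is the R-dual of [u]. *)
Section Precomp.
Variables (R : comNzRingType) (A B N : lmodType R) (u : {linear A -> B}).

Definition precomp (f : HomR B N) : HomR A N := f \o u.

Fact precomp_linear : linear precomp.
Proof. by move=> a f g; apply: linear_ext. Qed.
HB.instance Definition _ := GRing.isLinear.Build R (HomR B N) (HomR A N) _
  precomp precomp_linear.

End Precomp.

Arguments precomp {R A B} N u.

Section KerIm.
Variables (R : comNzRingType) (V W : lmodType R) (f : {linear V -> W}).

Definition ker_pred : {pred V} := [pred x | f x == 0].
Definition im_pred : {pred W} := [pred y | `[< exists x, f x = y >]].

Fact ker_submod : submod_closed ker_pred.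
Proof.
split=> [|a x y /eqP fx /eqP fy]; first by rewrite inE linear0.
by rewrite inE linearP fx fy scaler0 addr0.
Qed.
HB.instance Definition _ := GRing.isSubmodClosed.Build R V ker_pred ker_submod.

Fact im_submod : submod_closed im_pred.
Proof.
split=> [|a _ _ /asboolP[x <-] /asboolP[y <-]].
  by apply/asboolP; exists 0; rewrite linear0.
by apply/asboolP; exists (a *: x + y); rewrite linearP.
Qed.
HB.instance Definition _ := GRing.isSubmodClosed.Build R W im_pred im_submod.

Record Ker_type := Ker_elt { ker_val : V; _ : ker_val \in ker_pred }.
HB.instance Definition _ := [isSub for ker_val].
HB.instance Definition _ := [Choice of Ker_type by <:].
HB.instance Definition _ := [SubChoice_isSubLmodule of Ker_type by <:].
Definition Ker : lmodType R := Ker_type.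

End KerIm.

(* Scaling on the quotient group [Quotient.quot U] of the library. *)
Section QuotientModule.
Variables (R : comNzRingType) (V : lmodType R) (U : {pred V}).
Hypothesis modU : submod_closed U.

Definition submod_pred of submod_closed U : {pred V} := U.
HB.instance Definition _ :=
  GRing.isSubmodClosed.Build R V (submod_pred modU) modU.

Local Notation Q := (Quotient.quot (submod_pred modU)).

Definition quot_scale (a : R) (x : Q) : Q := \pi_Q (a *: repr x).

Fact pi_quot_scale a x : \pi_Q (a *: x) = quot_scale a (\pi_Q x).
Proof.
apply/eqP; rewrite piE Quotient.equivE -scalerBr rpredZ //.
by rewrite Quotient.idealrBE reprK.
Qed.

Fact quot_scaleA a b x : quot_scale a (quot_scale b x) = quot_scale (a * b) x.
Proof.
by elim/quotW: x => x; rewrite -(pi_quot_scale b) -!pi_quot_scale scalerA.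
Qed.
Fact quot_scale1 : left_id 1 quot_scale.
Proof. by elim/quotW=> x; rewrite -pi_quot_scale scale1r. Qed.
Fact quot_scaleDr : right_distributive quot_scale +%R.
Proof.
move=> a; elim/quotW=> x; elim/quotW=> y.
by rewrite -raddfD -!pi_quot_scale -raddfD scalerDr.
Qed.
Fact quot_scaleDl x : {morph quot_scale^~ x : a b / a + b}.
Proof.
by elim/quotW: x => x a b; rewrite -!pi_quot_scale -raddfD scalerDl.
Qed.
HB.instance Definition _ := GRing.Zmodule_isLmodule.Build R Q
  quot_scaleA quot_scale1 quot_scaleDr quot_scaleDl.

Definition Quot : lmodType R := Q.

End QuotientModule.

Definition Coker (R : comNzRingType) (V W : lmodType R) (f : {linear V -> W}) :
  lmodType R := Quot (im_submod f).

(* [{freeg K / R}] is the free R-module on [K], and [fglift b] the linear map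
   extending [b : K -> M]. *)
Section Free.
Variables (R : comNzRingType) (M : lmodType R).

Fact fglift_linear (K : choiceType) (b : K -> M) :
  linear (fglift b : {freeg K / R} -> M).
Proof.
have addb : {morph fglift b : D E / D - E} by exact: lift_is_additive.
have b0 : fglift b 0 = 0 by rewrite -(subrr 0) addb subrr.
have addbD : {morph fglift b : D E / D + E}.
  move=> D E; rewrite -{1}[E]opprK addb -[- E]add0r addb b0 sub0r.
  by rewrite opprK.
move=> a D E; rewrite addbD; congr (_ + _).
rewrite -[in RHS](freeg_sumE D) -[a *: D]/(fgscale a D) /fgscale.
rewrite !(big_morph _ addbD b0) scaler_sumr.
by apply: eq_bigr => x _; rewrite !liftU scalerA.
Qed.
HB.instance Definition _ (K : choiceType) (b : K -> M) :=
  GRing.isLinear.Build R {freeg K / R} M _ (fglift b) (fglift_linear b).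

Definition is_basis (K : choiceType) (b : K -> M) : Prop :=
  bijective (fglift b : {freeg K / R} -> M).

Definition is_free : Prop :=
  exists (K : choiceType) (b : K -> M), is_basis b.

Definition fin_gen : Prop :=
  exists (n : nat) (g : 'I_n -> M),
    forall x, exists a : 'I_n -> R, x = \sum_(i < n) a i *: g i.

End Free.

(* The free resolution
     ... -> {freeg Syz 2 / R} -> {freeg Syz 1 / R} -> {freeg M / R} -> M -> 0
   in which each module is covered by the free module on its own elements. *)
Section Resolution.
Variables (R : comNzRingType) (M : lmodType R).

Definition free_cover (V : lmodType R) : {linear {freeg V / R} -> V} :=
  fglift id.

Fixpoint Syz (n : nat) : lmodType R :=
  if n is n'.+1 then Ker (free_cover (Syz n')) else M.

Definition Res (n : nat) : lmodType R := {freeg (Syz n) / R}.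

Definition res_diff (n : nat) : {linear Res n.+1 -> Res n} :=
  (\val : Syz n.+1 -> Res n) \o free_cover (Syz n.+1).

End Resolution.

Section Ext.
Variables (R : comNzRingType) (M N : lmodType R).

Definition ext_diff (i : nat) :
    {linear HomR (Res M i) N -> HomR (Res M i.+1) N} :=
  precomp N (res_diff M i).

Definition coboundary (i : nat) : {pred HomR (Res M i) N} :=
  if i is j.+1 then im_pred (ext_diff j) else pred1 0.
Arguments coboundary i _ : clear implicits.

Fact coboundary_submod (i : nat) :
  submod_closed [pred z : Ker (ext_diff i) | val z \in coboundary i].
Proof.
have [C0 CP] : submod_closed (coboundary i).
  case: i => [|i]; last exact: im_submod.
  by split=> [|a x y]; rewrite !inE // => /eqP-> /eqP->; rewrite scaler0 addr0.
split=> [|a x y]; rewrite !inE ?linear0 // => xC yC.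
by rewrite linearP; apply: CP.
Qed.

(* The i-th cohomology module of Hom_R(Res M, N). *)
Definition Ext (i : nat) : lmodType R := Quot (coboundary_submod i).

End Ext.

Arguments coboundary {R} M N i _.

Definition is_zero (R : comNzRingType) (M : lmodType R) : Prop :=
  forall x : M, x = 0.

Definition is_max_nat (P : nat -> Prop) (n : nat) : Prop :=
  P n /\ forall k, P k -> (k <= n)%N.

Section RingNotions.
Variable R : comNzRingType.
Implicit Types (I P m : {pred R}) (s : seq R) (M : lmodType R).

Definition noetherian : Prop :=
  forall I : {pred R^o}, submod_closed I ->
    exists (n : nat) (g : 'I_n -> R), (forall i, g i \in I) /\
      forall x, x \in I -> exists a : 'I_n -> R, x = \sum_(i < n) a i * g i.

(* [idealr_closed] includes properness: 1 is not in the ideal. *)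
Definition maximal_ideal m : Prop :=
  idealr_closed m /\
  forall I, idealr_closed I -> {subset m <= I} -> {subset I <= m}.

Definition local_ring m : Prop :=
  maximal_ideal m /\ forall m', maximal_ideal m' -> m' =i m.

Definition prime_ideal P : Prop := idealr_closed P /\ prime_idealr_closed P.

Definition prime_chain (n : nat) (c : nat -> {pred R}) : Prop :=
  (forall i, (i <= n)%N -> prime_ideal (c i)) /\
  (forall i, (i < n)%N ->
     {subset c i <= c i.+1} /\ ~ {subset c i.+1 <= c i}).

Definition krull_dim (d : nat) : Prop :=
  is_max_nat (fun n => exists c, prime_chain n c) d.

(* [x] lies in the submodule (s_0, ..., s_{n-1})M of M. *)
Definition in_smul s M (x : M) : Prop :=
  exists y : nat -> M, x = \sum_(i < size s) s`_i *: y i.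

(* s_i is a nonzerodivisor on M/(s_0, ..., s_{i-1})M for every i, and
   M/sM is nonzero. *)
Definition regular_seq M s : Prop :=
  (forall i, (i < size s)%N -> forall x : M,
     in_smul (take i s) (s`_i *: x) -> in_smul (take i s) x) /\
  (exists x : M, ~ in_smul s x).

Definition depth m M (n : nat) : Prop :=
  is_max_nat (fun k => exists s : seq R,
    [/\ size s = k, {subset s <= m} & regular_seq M s]) n.

Definition cohen_macaulay_local m (d : nat) : Prop :=
  [/\ noetherian, local_ring m, krull_dim d & depth m R^o d].

(* [d] is meant to be the Krull dimension of R. *)
Definition max_cohen_macaulay m (d : nat) M : Prop :=
  [/\ ~ is_zero M, fin_gen M & depth m M d].

End RingNotions.

(* A presentation R^q --mp_d--> R^p --mp_e--> M --> 0; minimality says that the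
   image of [mp_d] lies in mR^p and its kernel in mR^q. *)
Record min_presentation (R : comNzRingType) (m : {pred R}) (M : lmodType R) :=
  MinPresentation {
    mp_p : nat;
    mp_q : nat;
    mp_d : {linear 'rV[R]_mp_q -> 'rV[R]_mp_p};
    mp_e : {linear 'rV[R]_mp_p -> M};
    mp_surj : forall y, exists x, mp_e x = y;
    mp_exact : forall x, mp_e x = 0 <-> exists z, mp_d z = x;
    mp_min_d : forall z j, mp_d z ord0 j \in m;
    mp_min_k : forall z, mp_d z = 0 -> forall j, z ord0 j \in m }.

Definition Tr (R : comNzRingType) (m : {pred R}) (M : lmodType R)
    (P : min_presentation m M) : lmodType R :=
  Coker (precomp (R^o : lmodType R) (mp_d P)).

(* Main.v *)
(* Let Y = Tr M and let y in m be regular on N. As Ext^1(M, N) = 0,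
   multiplication by y on Hom(M, N) has cokernel Hom(M, N/yN), so the long exact
   sequences carry both families of vanishing from N to N/yN, with one degree
   less. After d steps there is a finitely generated L of depth 0 with
   Ext^1(Y, Hom(M, L)) = 0, and L contains some u <> 0 killed by m.
   Let R^q --D--> R^p --> M be the minimal presentation, e_i the images in M of
   the standard basis, and W the kernel of the dual D^*. Suppose x in R^p is such
   that w(x) is in m for all w in W, and let f : M -> L send the class of b to
   b_j u, which is well defined since D has entries in m. Then w |-> w(x) f kills
   W, hence it is h o D^* for some h, as Ext^1(Y, Hom(M, L)) = 0. On coordinates
   this reads x_i f = sum_l D_il h_l, so the class of x is sent by f to
   x_j u = sum_i x_i f(e_i) = sum_l h_l (sum_i D_il e_i) = 0, and x_j is in m.
   Thus W separates the points of (R/m)^p, so it spans the dual of R^p by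
   Nakayama, and D = 0. *)
From HB Require Import structures.
Require Import Defs.
From mathcomp Require Import all_boot all_algebra.
From mathcomp Require Import boolp.

Set Implicit Arguments.
Unset Strict Implicit.
Unset Printing Implicit Defensive.

Import GRing.Theory.
Local Open Scope ring_scope.
Local Open Scope quotient_scope.

(* Rewriting with these instead of simplifying keeps [res_diff] folded. *)
Lemma comp_at (R : comNzRingType) (A B C : lmodType R)
    (f : {linear B -> C}) (g : {linear A -> B}) x :
  (f \o g : {linear A -> C}) x = f (g x).
Proof. by []. Qed.

Lemma sub_at (R : comNzRingType) (A B : lmodType R) (f g : {linear A -> B}) x :
  (f \- g : {linear A -> B}) x = f x - g x.
Proof. by []. Qed.

(** * Linear maps and Ext *)

Section LinearMaps.
Variable R : comNzRingType.

Lemma linear_exists (A B : lmodType R) (f : A -> B) :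
  linear f -> exists g : {linear A -> B}, g =1 f.
Proof.
move=> flin.
pose g : {linear A -> B} := HB.pack f (GRing.isLinear.Build R A B _ f flin).
by exists g.
Qed.

Lemma linear_factor (A B C : lmodType R) (p : {linear A -> B})
    (h : {linear A -> C}) :
  (forall b, exists a, p a = b) -> (forall a, p a = 0 -> h a = 0) ->
  exists h' : {linear B -> C}, forall a, h' (p a) = h a.
Proof.
move=> /choice[s ps] kerh.
have hE a a' : p a = p a' -> h a = h a'.
  by move=> e; apply/subr0_eq; rewrite -linearB kerh // linearB e subrr.
have [|h' h'E] := @linear_exists B C (h \o s).
  by move=> k x y; rewrite /= -linearP; apply: hE; rewrite linearP !ps.
by exists h' => a; rewrite h'E /=; apply: hE; rewrite ps.
Qed.

Lemma linear_corestrict (A B C : lmodType R) (i : {linear B -> C})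
    (h : {linear A -> C}) :
  injective i -> (forall a, exists b, h a = i b) ->
  exists h' : {linear A -> B}, forall a, i (h' a) = h a.
Proof.
move=> inji /choice[s hs].
have [|h' h'E] := @linear_exists A B s.
  by move=> k x y; apply: inji; rewrite linearP -!hs linearP.
by exists h' => a; rewrite h'E.
Qed.

(** Projectivity of a free module. Only the values of [h] on generators need preimages, so [p] may
    fail to be surjective. *)
Lemma freeg_lift (K : choiceType) (A B : lmodType R) (p : {linear A -> B})
    (h : {linear {freeg K / R} -> B}) :
  (forall k, exists a, p a = h << k >>) ->
  exists h' : {linear {freeg K / R} -> A}, forall w, p (h' w) = h w.
Proof.
move=> /choice[s ps]; exists (fglift s : {linear {freeg K / R} -> A}) => w.
rewrite -(freeg_sumE w) !linear_sum; apply: eq_bigr => k _.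
have -> : << coeff k w *g k >> = coeff k w *: << k >> :> {freeg K / R}.
  by apply/eqP/freeg_eqP=> y; rewrite coeff_fgscale !coeffU mul1r.
by rewrite !linearZ /= liftU scale1r ps.
Qed.

End LinearMaps.

Section Resolution.
Variables (R : comNzRingType) (M : lmodType R).

Lemma free_coverU (V : lmodType R) (v : V) : free_cover V << v >> = v.
Proof. by rewrite /free_cover /= liftU scale1r. Qed.

Lemma free_cover_res_diff i (u : Res M i.+1) :
  free_cover (Syz M i) (res_diff M i u) = 0.
Proof. by rewrite /res_diff /=; case: (fglift _ u) => x /= /eqP. Qed.

Lemma res_diffK i (u : Res M i.+2) : res_diff M i (res_diff M i.+1 u) = 0.
Proof.
by rewrite {1}/res_diff /= (free_cover_res_diff (i := i.+1)).
Qed.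

Lemma res_diff_exact i (w : Res M i) :
  free_cover (Syz M i) w = 0 -> exists u, res_diff M i u = w.
Proof.
move=> /eqP w0.
exists << (Ker_elt w0 : Syz M i.+1) >>.
by rewrite /res_diff /= liftU scale1r.
Qed.

End Resolution.

(* [ext_vanish Y X i] is the vanishing of Ext^(i+1)(Y, X). *)
Definition ext_vanish (R : comNzRingType) (Y X : lmodType R) (i : nat) : Prop :=
  forall z : {linear Res Y i.+1 -> X}, (forall w, z (res_diff Y i.+1 w) = 0) ->
  exists g : {linear Res Y i -> X}, forall w, g (res_diff Y i w) = z w.

Section Ext.
Variable R : comNzRingType.

Lemma is_zero_ext (Y X : lmodType R) i :
  is_zero (Ext Y X i.+1) -> ext_vanish Y X i.
Proof.
move=> Ext0 z dz.
have z_ker : (z : HomR (Res Y i.+1) X) \in ker_pred (ext_diff Y X i.+1).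
  by rewrite inE; apply/eqP; apply: linear_ext => w; apply: dz.
set Q := Quotient.quot (submod_pred (coboundary_submod Y X i.+1)).
have := Ext0 (\pi_Q (Ker_elt z_ker)).
rewrite -[RHS](raddf0 \pi_Q) => /eqP.
rewrite piE Quotient.equivE subr0 /= => /asboolP[g gz].
by exists g => w; rewrite -[z]gz.
Qed.

(** A chase in the long exact sequence of 0 -> A -> A -> B -> 0. A cocycle [z] lifts along [p] to a
    cochain [a], whose differential is [x] of a cocycle [c]. As [c] bounds some [e], the difference
    [a \- (x \o e)] is a cocycle that still lifts [z]. *)
Lemma ext_vanish_quotient (Y A B : lmodType R) (x : {linear A -> A})
    (p : {linear A -> B}) i :
  injective x -> (forall b, exists a, p a = b) ->
  (forall a, p a = 0 <-> exists a', a = x a') ->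
  ext_vanish Y A i -> ext_vanish Y A i.+1 -> ext_vanish Y B i.
Proof.
move=> injx surjp kerp ext_i ext_i1 z dz.
have [a pa] := freeg_lift (h := z) (fun k => surjp (z << k >>)).
have [w|c xc] := @linear_corestrict _ _ _ _ x (a \o res_diff Y i.+1) injx.
  by apply/kerp; rewrite comp_at pa dz.
have [w|e de] := ext_i1 c.
  by apply: injx; rewrite xc comp_at res_diffK !linear0.
have [w|g dg] := ext_i (a \- (x \o e)).
  by rewrite sub_at !comp_at de xc subrr.
exists (p \o g) => w; rewrite comp_at dg sub_at comp_at linearB pa.
by have /kerp-> : exists a', x (e w) = x a'; [exists (e w) | rewrite subr0].
Qed.

(** The same chase one degree lower: the corrected lift kills the syzygies, so it descends to M. *)
Lemma ext_vanish_hom_lift (M A B : lmodType R) (x : {linear A -> A})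
    (p : {linear A -> B}) (f : {linear M -> B}) :
  injective x -> (forall b, exists a, p a = b) ->
  (forall a, p a = 0 <-> exists a', a = x a') ->
  ext_vanish M A 0 -> exists f' : {linear M -> A}, forall y, p (f' y) = f y.
Proof.
move=> injx surjp kerp ext0.
have [a pa] := freeg_lift (h := f \o free_cover M)
  (fun k => surjp ((f \o free_cover M) << k >>)).
have [w|c xc] := @linear_corestrict _ _ _ _ x (a \o res_diff M 0) injx.
  by apply/kerp; rewrite comp_at pa comp_at (free_cover_res_diff (i := 0)) linear0.
have [w|e de] := ext0 c.
  by apply: injx; rewrite xc comp_at res_diffK !linear0.
have [y|w w0|f' f'E] := @linear_factor _ _ _ _ (free_cover M) (a \- (x \o e)).
- by exists << y >>; rewrite free_coverU.
- have [u <-] := res_diff_exact (i := 0) w0.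
  by rewrite sub_at !comp_at de xc subrr.
exists f' => y; rewrite -(free_coverU y) f'E sub_at comp_at linearB pa comp_at.
by have /kerp-> : exists a', x (e << y >>) = x a';
  [exists (e << y >>) | rewrite subr0].
Qed.

(** Ext^1 may be tested on any presentation A -> B -> Y -> 0 in place of [Res Y]: the comparison
    maps [s0] and [s1] turn [h] into a cocycle [h \o s1], which is the coboundary of some [g]. *)
Lemma ext_vanish_extend (X A B Y : lmodType R) (D : {linear A -> B})
    (p : {linear B -> Y}) (h : {linear A -> X}) :
  (forall y, exists b, p b = y) ->
  (forall b, p b = 0 <-> exists a, D a = b) ->
  (forall a, D a = 0 -> h a = 0) ->
  ext_vanish Y X 0 -> exists h' : {linear B -> X}, forall a, h' (D a) = h a.
Proof.
move=> surjp kerp kerh ext0.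
have [s0 ps0] := freeg_lift (h := free_cover Y)
  (fun k => surjp (free_cover Y << k >>)).
have s0ker w : exists a, D a = (s0 \o res_diff Y 0) w.
  by apply/kerp; rewrite comp_at ps0 (free_cover_res_diff (i := 0)).
have [s1 Ds1] := freeg_lift (h := s0 \o res_diff Y 0) (fun k => s0ker << k >>).
have [w|g dg] := ext0 (h \o s1).
  by rewrite comp_at; apply: kerh; rewrite Ds1 comp_at res_diffK linear0.
(* [D] and [s0] together map A x [Res Y 0] onto B, so [h] and [g] together define a map on B once
   they kill the kernel. *)
have [|h1 h1E] := @linear_exists _ (A * Res Y 0)%type X (fun u => h u.1 + g u.2).
  by move=> k u v /=; rewrite !linearP /= scalerDr addrACA.
have [|q qE] := @linear_exists _ (A * Res Y 0)%type B (fun u => D u.1 + s0 u.2).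
  by move=> k u v /=; rewrite !linearP /= scalerDr addrACA.
have [b|[a w]|h' h'E] := @linear_factor _ _ _ _ q h1.
- have : p (b - s0 << p b >>) = 0 by rewrite linearB ps0 free_coverU subrr.
  by move=> /kerp[a Da]; exists (a, << p b >>); rewrite qE /= Da subrK.
- rewrite qE h1E /= => Daw.
  have : free_cover Y w = 0.
    have pD : p (D a) = 0 by apply/kerp; exists a.
    by rewrite -ps0 -[LHS]add0r -pD -linearD Daw linear0.
  move=> /(res_diff_exact (i := 0))[u uw]; rewrite -uw dg comp_at -linearD.
  by apply: kerh; rewrite linearD Ds1 comp_at uw.
exists h' => a; have := h'E (a, 0).
by rewrite qE h1E /= !linear0 !addr0.
Qed.

End Ext.

(** * Reduction modulo a regular sequence *)

Section RegularSequences.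
Variable R : comNzRingType.

Lemma scaling_quotient (N : lmodType R) (y : R) :
  exists (L : lmodType R) (p : {linear N -> L}),
    (forall l, exists v, p v = l) /\
    (forall v, p v = 0 <-> exists v', v = y *: v').
Proof.
pose f : {linear N -> N} := y \*: idfun.
pose Q := Quotient.quot (submod_pred (im_submod f)).
have [|p pE] := @linear_exists R N (Coker f) (\pi_Q : N -> Coker f).
  move=> a u v; rewrite raddfD; congr (_ + _).
  exact: (pi_quot_scale (im_submod f)).
exists (Coker f), p; split=> [l|v].
  by exists (repr (l : Q)); rewrite pE reprK.
rewrite pE; split=> [|[v' ->]].
  rewrite -[RHS](raddf0 \pi_Q) => /eqP.
  rewrite piE Quotient.equivE subr0 /= => /asboolP[g gz].
  by exists g; rewrite -gz.
rewrite -[RHS](raddf0 \pi_Q); apply/eqP.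
by rewrite piE Quotient.equivE subr0 /=; apply/asboolP; exists v'.
Qed.

Lemma fin_gen_quotient (N L : lmodType R) (p : {linear N -> L}) :
  (forall l, exists v, p v = l) -> fin_gen N -> fin_gen L.
Proof.
move=> surjp [n [g gN]]; exists n, (p \o g) => l.
have [v <-] := surjp l; have [a ->] := gN v; exists a.
by rewrite linear_sum; apply: eq_bigr => i _; rewrite linearZ.
Qed.

Section Quotient.
Variables (N L : lmodType R) (p : {linear N -> L}) (y : R).
Hypothesis surjp : forall l, exists v, p v = l.
Hypothesis kerp : forall v, p v = 0 <-> exists v', v = y *: v'.

Lemma in_smul_quotient t v : in_smul (y :: t) v <-> in_smul t (p v).
Proof.
split=> [[z ->]|[z pv]].
  exists (fun i => p (z i.+1)).
  rewrite big_ord_recl linearD (_ : p (_ *: _) = 0) ?add0r.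
    by rewrite linear_sum; apply: eq_bigr => i _; rewrite linearZ.
  by apply/kerp; exists (z 0%N).
have [z' pz'] := choice (fun i => surjp (z i)).
have : p (v - \sum_(i < size t) t`_i *: z' i) = 0.
  rewrite linearB pv linear_sum -sumrB big1 // => i _.
  by rewrite linearZ /= pz' subrr.
move=> /kerp[v' vE]; exists (fun i => if i is j.+1 then z' j else v').
by rewrite big_ord_recl /= -vE subrK.
Qed.

Lemma regular_seq_cons t :
  regular_seq N (y :: t) <->
  (forall v : N, y *: v = 0 -> v = 0) /\ regular_seq L t.
Proof.
have smul0 (v : N) : in_smul [::] v <-> v = 0.
  by split=> [[z ->]|->]; [rewrite big_ord0 | exists (fun=> 0); rewrite big_ord0].
split=> [[reg [v Nv]]|[regy [reg [l Nl]]]]; split.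
- by move=> u yu; apply/smul0/(reg 0%N) => //; apply/smul0.
- split=> [i lti l|]; last by exists (p v); rewrite -in_smul_quotient.
  have [u <-] := surjp l; rewrite -linearZ -!in_smul_quotient.
  exact: (reg i.+1).
- case=> [|i] lti u /=; first by move=> /smul0/regy->; apply/smul0.
  by rewrite !in_smul_quotient linearZ; apply: reg.
- by have [u ul] := surjp l; exists u; rewrite in_smul_quotient ul.
Qed.

(** Surjectivity of [q] is where Ext^1(M, N) = 0 enters; its kernel comes from left exactness of
    Hom. *)
Lemma hom_quotient (M : lmodType R) :
  (forall v : N, y *: v = 0 -> v = 0) -> ext_vanish M N 0 ->
  exists q : {linear HomR M N -> HomR M L},
    (forall l, exists f, q f = l) /\
    (forall f, q f = 0 <-> exists f', f = y *: f').
Proof.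
move=> regy ext0.
have injy : injective (y \*: idfun : {linear N -> N}).
  by move=> u v /eqP; rewrite -subr_eq0 -scalerBr => /eqP/regy/subr0_eq.
have [|q qE] :=
    @linear_exists R (HomR M N) (HomR M L) (fun f => p \o (f : {linear M -> N})).
  by move=> a f g; apply: linear_ext => v /=; rewrite linearP.
exists q; split=> [l|f].
  have [f pf] := ext_vanish_hom_lift l injy surjp kerp ext0.
  by exists f; rewrite qE; apply: linear_ext.
rewrite qE; split=> [pf0|[f' ->]]; last first.
  by apply: linear_ext => v /=; apply/kerp; exists (f' v).
have [v|f' f'E] := linear_corestrict (h := f) injy.
  by apply/kerp; rewrite -[LHS]/((p \o f : HomR M L) v) pf0.
by exists f'; apply: linear_ext => v; rewrite -f'E.
Qed.

End Quotient.

Lemma ext_vanish_regular_quotient (Y N L : lmodType R) (p : {linear N -> L}) y i :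
  (forall v : N, y *: v = 0 -> v = 0) -> (forall l, exists v, p v = l) ->
  (forall v, p v = 0 <-> exists v', v = y *: v') ->
  ext_vanish Y N i -> ext_vanish Y N i.+1 -> ext_vanish Y L i.
Proof.
move=> regy; apply: (@ext_vanish_quotient R Y N L (y \*: idfun)).
by move=> u v /eqP; rewrite -subr_eq0 -scalerBr => /eqP/regy/subr0_eq.
Qed.

(** Induction on [d], dividing by the first term of a maximal regular sequence. Each quotient costs
    both families their top degree, so after [d] steps Ext^1 is what remains of the second. *)
Lemma ext_vanish_reduction (m : {pred R}) (M Y N : lmodType R) d :
  fin_gen N -> depth m N d ->
  (forall i, (i < d)%N -> ext_vanish M N i) ->
  (forall i, (i <= d)%N -> ext_vanish Y (HomR M N) i) ->
  exists L : lmodType R,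
    [/\ fin_gen L, depth m L 0 & ext_vanish Y (HomR M L) 0].
Proof.
elim: d N => [|d IH] N genN depthN extM extY.
  by exists N; split=> //; apply: extY.
have [[[|y t] [//= [szt] subm regN]] maxN] := depthN.
have [L [p [surjp kerp]]] := scaling_quotient N y.
have [regy regL] := (regular_seq_cons surjp kerp t).1 regN.
have [q [surjq kerq]] := hom_quotient surjp kerp regy (extM 0%N isT).
apply: (IH L) => [||i ltid|i leid].
- exact: fin_gen_quotient genN.
(* Depth drops by exactly one: the tail [t] is regular on [L], and [y] put before a regular sequence
   on [L] gives one on N. *)
- split=> [|k [t' [szt' subt' regt']]].
    by exists t; split=> // x xt; apply: subm; rewrite inE xt orbT.
  apply: (maxN k.+1); exists (y :: t'); split; first by rewrite /= szt'.
    by move=> x; rewrite inE => /predU1P[->|/subt'//]; rewrite subm ?mem_head.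
  exact/(regular_seq_cons surjp kerp).
- by apply: (ext_vanish_regular_quotient regy surjp kerp); apply: extM => //; apply: ltnW.
- have regyH (f : HomR M N) : y *: f = 0 -> f = 0.
    move=> yf; apply: linear_ext => v; apply: regy.
    by rewrite -[LHS]/((y *: f) v) yf.
  by apply: (ext_vanish_regular_quotient regyH surjq kerq); apply: extY => //; apply: leqW.
Qed.

End RegularSequences.

(** * Socles of modules of depth zero *)

Section Submodule.
Variables (R : comNzRingType) (V : lmodType R) (U : {pred V}).
Hypothesis modU : submod_closed U.

Lemma submod_sum n (a : 'I_n -> R) (g : 'I_n -> V) :
  (forall i, g i \in U) -> \sum_i a i *: g i \in U.
Proof.
move=> gU; rewrite -[_ \in U]/(_ \in submod_pred modU).
by apply: rpred_sum => i _; apply: rpredZ; apply: gU.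
Qed.

Lemma submod_sub x y : x \in U -> y \in U -> x - y \in U.
Proof. exact: (@rpredB _ (submod_pred modU)). Qed.

End Submodule.

(** * Chain conditions, finitely generated submodules and Nakayama's lemma *)

Section NoetherianLocal.
Variable R : comNzRingType.
Hypothesis noethR : noetherian R.

(** An endless strictly ascending chain would have a union with finitely many generators, all
    present at one stage [B]. The index type lets this serve both ideals and annihilators. *)
Lemma noetherian_maximal (T : Type) (F : T -> {pred R}) (t0 : T) :
  (forall t, submod_closed (F t : {pred R^o})) ->
  exists t, {subset F t0 <= F t} /\
    forall t', {subset F t <= F t'} -> {subset F t' <= F t}.
Proof.
move=> modF; apply: contrapT => nomax.
(* Placing the premise under the existential makes [next] total, so that it can be iterated. *)
have step t : exists t', {subset F t0 <= F t} ->
    {subset F t <= F t'} /\ ~ {subset F t' <= F t}.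
  have [t0t|] := pselect {subset F t0 <= F t}; last by exists t.
  apply: contrapT => no_t'; apply: nomax; exists t; split=> // t' tt'.
  by apply: contrapT => t't; apply: no_t'; exists t'.
have [next nextP] := choice step.
pose c n := iter n next t0.
have t0c n : {subset F t0 <= F (c n)}.
  by elim: n => //= n IH x /IH; apply: (nextP _ IH).1.
have c_mono i j : (i <= j)%N -> {subset F (c i) <= F (c j)}.
  move=> /subnK<-; elim: (j - i)%N => //= k IH x /IH.
  by apply: (nextP _ (t0c _)).1.
pose U : {pred R^o} := [pred x | `[< exists n, x \in F (c n) >]].
have [|n [g [gU Ug]]] := noethR (I := U).
  split=> [|a x y /asboolP[i xi] /asboolP[j yj]]; apply/asboolP.
    by exists 0%N; case: (modF (c 0%N)).
  exists (maxn i j); case: (modF (c (maxn i j))) => _; apply.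
    exact: c_mono (leq_maxl _ _) _ xi.
  exact: c_mono (leq_maxr _ _) _ yj.
have [N gN] := choice (fun i => asboolP _ (gU i)).
pose B := \max_(i < n) N i.
have [_ []] := nextP _ (t0c B); move=> x xB.
have /Ug[a ->] : x \in U by apply/asboolP; exists B.+1.
apply: (submod_sum (modF (c B))) => i.
exact: c_mono (leq_bigmax i) _ (gN i).
Qed.

(** Induction on the number of generators of V. Lifts of generators of the ideal of coefficients at
    [g ord0] generate U together with generators of [U'], the part of U spanned by the other [g]. *)
Lemma fin_gen_submod (V : lmodType R) (U : {pred V}) :
  submod_closed U -> fin_gen V ->
  exists (n : nat) (g : 'I_n -> V), (forall i, g i \in U) /\
    forall x, x \in U -> exists a : 'I_n -> R, x = \sum_i a i *: g i.
Proof.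
move=> modU [n [g genV]].
(* The induction asks only that [g] span U, since the remaining generators span [U'] but perhaps not
   V. *)
have {genV} genU x : x \in U -> exists a : 'I_n -> R, x = \sum_i a i *: g i.
  by move=> _; apply: genV.
elim: n => [|n IH] in g U modU genU *.
  by exists 0%N, g; split=> [[]|].
pose spans (b : 'I_n -> R) := \sum_i b i *: g (lift ord0 i).
have spansP a b c : a *: spans b + spans c = spans (fun i => a * b i + c i).
  rewrite /spans scaler_sumr -big_split.
  by apply: eq_bigr => i _; rewrite /= scalerDl scalerA.
have spans0 : spans (fun=> 0) = 0.
  by rewrite /spans big1 // => i _; rewrite scale0r.
have [U0 UP] := modU.
pose I : {pred R^o} :=
  [pred a | `[< exists b, a *: g ord0 + spans b \in U >]].
have [|k [r [rI Ir]]] := noethR (I := I).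
  split=> [|a x y /asboolP[b bU] /asboolP[c cU]]; apply/asboolP.
    by exists (fun=> 0); rewrite scale0r spans0 addr0.
  exists (fun i => a * b i + c i).
  rewrite -spansP scalerDl -scalerA addrACA -scalerDr.
  exact: UP.
have [h hU] := choice (fun i => asboolP _ (rI i)).
pose u i := r i *: g ord0 + spans (h i).
pose U' : {pred V} := [pred x | (x \in U) && `[< exists b, x = spans b >]].
have [||l [w [wU' U'w]]] := IH (fun i => g (lift ord0 i)) U'.
- split=> [|a x y /andP[xU /asboolP[b xb]] /andP[yU /asboolP[c yc]]].
    by rewrite inE U0; apply/asboolP; exists (fun=> 0); rewrite spans0.
  apply/andP; split; first exact: UP.
  by apply/asboolP; exists (fun i => a * b i + c i); rewrite -spansP xb yc.
- by move=> x /andP[_ /asboolP].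
pose f i := match split i with inl j => u j | inr j => w j end.
exists (k + l)%N, f; split=> [i|x xU].
  by rewrite /f; case: split => j; [exact: hU | case/andP: (wU' j)].
have [a xE] := genU x xU.
have /Ir[c a0E] : (a ord0 : R^o) \in I.
  apply/asboolP; exists (fun i => a (lift ord0 i)).
  by rewrite -[_ + _](_ : x = _) // xE big_ord_recl.
have sumE : \sum_i c i *: u i =
    a ord0 *: g ord0 + spans (fun j => \sum_i c i * h i j).
  rewrite a0E scaler_suml /spans.
  under [X in _ = _ + X]eq_bigr => j _ do rewrite scaler_suml.
  rewrite exchange_big -big_split; apply: eq_bigr => i _ /=.
  rewrite /u /spans scalerDr scalerA scaler_sumr; congr (_ + _).
  by apply: eq_bigr => j _; rewrite scalerA.
pose x' := x - \sum_i c i *: u i.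
have /U'w[e x'E] : x' \in U'.
  apply/andP; split; first exact/(submod_sub modU xU)/(submod_sum modU).
  apply/asboolP; exists (fun j => a (lift ord0 j) - \sum_i c i * h i j).
  rewrite /x' sumE {1}xE big_ord_recl opprD addrACA subrr add0r -sumrB.
  by apply: eq_bigr => j _; rewrite scalerBl.
exists (fun i => match split i with inl j => c j | inr j => e j end).
rewrite big_split_ord /= /f -[LHS](subrK (\sum_i c i *: u i)) -/x' x'E addrC.
by congr (_ + _); apply: eq_bigr => i _;
  rewrite -?[lshift _ i]/(unsplit (inl i)) -?[rshift _ i]/(unsplit (inr i)) unsplitK.
Qed.

Variable m : {pred R}.
Hypothesis localR : local_ring m.

Lemma local_ideal : idealr_closed m.
Proof. by case: localR => -[]. Qed.

Lemma local_submod : submod_closed (m : {pred R^o}).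
Proof. by case: local_ideal => m0 _ mP; split=> // a x y; apply: mP. Qed.

(** The multiples of a non-unit form a proper ideal; a maximal one above it exists by noetherianity
    and must be [m]. *)
Lemma local_inv a : a \notin m -> exists b, b * a = 1.
Proof.
move=> am; apply: contrapT => noinv.
pose T := {I : {pred R} | idealr_closed I /\ a \in I}.
have aR : idealr_closed [pred x | `[< exists b, x = b * a >]].
  split=> [||b x y /asboolP[c ->] /asboolP[e ->]].
  - by apply/asboolP; exists 0; rewrite mul0r.
  - by apply/asboolP => -[b ab]; apply: noinv; exists b.
  - by apply/asboolP; exists (b * c + e); rewrite mulrDl mulrA.
have aaR : a \in [pred x | `[< exists b, x = b * a >]].
  by apply/asboolP; exists 1; rewrite mul1r.
have [|[I [idI aI]] [_ maxI]] :=
    @noetherian_maximal T (fun t => sval t) (exist _ _ (conj aR aaR)).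
  by move=> [I p] /=; case: p => [[I0 _ IP] _]; split=> // b x y; apply: IP.
have /(localR.2)mI : maximal_ideal I.
  split=> // J idJ IJ; apply: (maxI (exist _ J (conj idJ (IJ _ aI)))).
  exact: IJ.
by rewrite -mI aI in am.
Qed.

(** As 1 - c_00 is a unit, the first relation expresses [g ord0] through the others; substituting it
    keeps all coefficients in [m] and leaves one generator fewer. *)
Lemma nakayama (V : lmodType R) n (g : 'I_n -> V) (c : 'I_n -> 'I_n -> R) :
  (forall i j, c i j \in m) -> (forall i, g i = \sum_j c i j *: g j) ->
  forall i, g i = 0.
Proof.
elim: n g c => [|n IH] g c cm gc; first by case.
have [m0 m1 mP] := local_ideal.
have [|b bc] := @local_inv (1 - c ord0 ord0).
  apply: contra m1 => c1.
  by rewrite -[1](subrK (c ord0 ord0)) -[_ - _]mul1r mP.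
pose g' i := g (lift ord0 i).
have g0 : g ord0 = \sum_j (b * c ord0 (lift ord0 j)) *: g' j.
  rewrite -[LHS]scale1r -bc -scalerA scalerBl scale1r.
  rewrite {1}gc big_ord_recl addrAC subrr add0r scaler_sumr.
  by apply: eq_bigr => j _; rewrite scalerA.
pose c' i j := (c (lift ord0 i) ord0 * b) * c ord0 (lift ord0 j)
  + c (lift ord0 i) (lift ord0 j).
have g'0 : forall i, g' i = 0.
  apply: (IH g' c') => [i j|i]; first exact: mP.
  rewrite {1}/g' gc big_ord_recl g0 scaler_sumr -big_split.
  by apply: eq_bigr => j _; rewrite /= /c' scalerDl scalerA mulrA.
move=> i; case: (unliftP ord0 i) => [j ->|->]; first exact: g'0.
by rewrite g0 big1 // => j _; rewrite g'0 scaler0.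
Qed.

Section Socle.
Variable V : lmodType R.
Hypothesis genV : fin_gen V.

Let kills (v : V) : {pred R} := [pred a | a *: v == 0].

(* The annihilators of such elements are the maximal associated primes of V. *)
Let maximal_kills (v : V) : Prop := v <> 0 /\
  forall u, u <> 0 -> {subset kills v <= kills u} -> {subset kills u <= kills v}.

Lemma kills_submod v : submod_closed (kills v : {pred R^o}).
Proof.
split=> [|a x y /eqP xv /eqP yv]; rewrite inE ?scale0r //.
by rewrite scalerDl -scalerA xv yv scaler0 addr0.
Qed.

Lemma maximal_kills_above v : v <> 0 ->
  exists2 u, maximal_kills u & {subset kills v <= kills u}.
Proof.
move=> v0; pose T := {u : V | u <> 0}.
have [|[u u0] [vu maxu]] :=
    @noetherian_maximal T (fun t => kills (sval t)) (exist _ v v0).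
  by move=> t; apply: kills_submod.
exists u => //; split=> // w w0; exact: (maxu (exist _ w w0)).
Qed.

(** The annihilator of [b *: v] contains that of [v], so by maximality they agree. *)
Lemma maximal_kills_prime v a b : maximal_kills v ->
  a *: v <> 0 -> b *: v <> 0 -> (a * b) *: v <> 0.
Proof.
move=> [v0 maxv] av bv abv; apply/av/eqP.
apply: (maxv (b *: v)) => //; last by rewrite inE scalerA abv.
by move=> c /eqP cv; rewrite inE scalerA mulrC -scalerA cv scaler0.
Qed.

(** A substitute for the finiteness of the set of associated primes. The elements killed by the
    common annihilator of some finite list form a submodule [U]. One list serves its finitely many
    generators, and [[:: v]] puts each maximal [v] in [U]. *)
Lemma finitely_many_maximal_kills : exists s : seq V,
  (forall v, v \in s -> maximal_kills v) /\
  forall v, maximal_kills v -> forall a, (forall u, u \in s -> a *: u = 0) ->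
    a *: v = 0.
Proof.
pose bounded (s : seq V) (x : V) := forall a, (forall u, u \in s -> a *: u = 0) ->
  a *: x = 0.
pose U : {pred V} := [pred x | `[< exists s : seq V,
  (forall v, v \in s -> maximal_kills v) /\ bounded s x >]].
have [|n [g [gU Ug]]] := @fin_gen_submod V U _ genV.
  split=> [|b x y /asboolP[s [smax sx]] /asboolP[t [tmax ty]]]; apply/asboolP.
    by exists [::]; split=> // a _; rewrite scaler0.
  exists (s ++ t); split=> [v|a ast].
    by rewrite mem_cat => /orP[/smax|/tmax].
  rewrite scalerDr scalerA mulrC -scalerA sx ?ty ?scaler0 ?addr0 // => u us;
    by apply: ast; rewrite mem_cat us ?orbT.
have [s sP] := choice (fun i => asboolP _ (gU i)).
exists (flatten [seq s i | i <- enum 'I_n]); split=> [v|v vmax a as0].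
  by move=> /flatten_mapP[i _ /(sP i).1].
have /Ug[b ->] : v \in U.
  apply/asboolP; exists [:: v]; split=> [u|c]; first by rewrite inE => /eqP->.
  by apply; rewrite mem_head.
rewrite scaler_sumr big1 // => i _.
rewrite scalerA mulrC -scalerA (sP i).2 ?scaler0 // => u us.
by apply: as0; apply/flatten_mapP; exists i; rewrite ?mem_enum.
Qed.

(** Take for [p] the product of [c] with one element from each annihilator along [s] lying outside
    that of [v]; primality keeps [p *: v] nonzero. *)
Lemma maximal_kills_separate (s : seq V) v c : maximal_kills v ->
  c \in m -> c *: v <> 0 ->
  (forall u, u \in s -> ~ {subset kills u <= kills v}) ->
  exists p, [/\ p \in m, p *: v <> 0 & forall u, u \in s -> p *: u = 0].
Proof.
move=> vmax cm cv; elim: s => [|w s IH] sv; first by exists c.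
have [|p [pm pv ps]] := IH.
  by move=> u us; apply: sv; rewrite inE us orbT.
have [a /eqP aw av] : exists2 a, a \in kills w & a *: v <> 0.
  apply: contrapT => noa; apply: (sv w (mem_head _ _)) => a aw.
  by apply/eqP; apply: contrapT => av; apply: noa; exists a.
have [m0 _ mP] := local_ideal.
exists (a * p); split; first by rewrite -[_ * _]addr0 mP.
- exact: maximal_kills_prime.
- move=> u; rewrite inE => /predU1P[->|us].
    by rewrite mulrC -scalerA aw scaler0.
  by rewrite -scalerA ps // scaler0.
Qed.

(* Prime avoidance among the maximal associated primes. *)
Lemma socle_or_regular :
  (exists2 v : V, v <> 0 & forall a, a \in m -> a *: v = 0) \/
  (exists2 y, y \in m & forall v : V, y *: v = 0 -> v = 0).
Proof.
have [?|nosocle] := pselect (exists2 v : V, v <> 0 &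
  forall a, a \in m -> a *: v = 0); [by left | right].
have moved (v : V) : v <> 0 -> exists2 c, c \in m & c *: v <> 0.
  move=> v0; apply: contrapT => noc; apply: nosocle; exists v => // a am.
  by apply: contrapT => av; apply: noc; exists a.
have [s [smax sP]] := finitely_many_maximal_kills.
(* If the [y] found for the rest of [s] kills the new [v], adding a [p] that kills that rest but not
   [v] repairs it. *)
have [y ym ys] : exists2 y, y \in m & forall u, u \in s -> y *: u <> 0.
  elim: s smax {sP} => [|v s IH] smax.
    by exists 0 => //; case: local_ideal.
  have [|y ym ys] := IH; first by move=> u us; apply: smax; rewrite inE us orbT.
  have [v0 maxv] := smax v (mem_head _ _).
  have [yv|yv] := pselect (y *: v = 0); last first.
    by exists y => // u; rewrite inE => /predU1P[->|/ys].
  have [c cm cv] := moved v v0.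
  have [|p [pm pv ps]] := maximal_kills_separate (smax v (mem_head _ _)) cm cv
    (s := s).
    move=> u us uv; have [u0 maxu] : maximal_kills u.
      by apply: smax; rewrite inE us orbT.
    by apply: (ys u us); apply/eqP; apply: (maxu v v0 uv); apply/eqP.
  exists (y + p); first by have [_ _ mP] := local_ideal; rewrite -[y]mul1r mP.
  move=> u; rewrite inE scalerDl => /predU1P[->|us]; first by rewrite yv add0r.
  by rewrite ps // addr0; apply: ys.
exists y => // v yv; apply: contrapT => v0.
have [u umax vu] := maximal_kills_above v0.
have [c cm cu] := moved u umax.1.
(* Otherwise some [p] would kill all of [s] but not [u], against the choice of [s]. By maximality of
   [w], the element [y], which kills [u], then kills [w]. *)
have [w [ws wu]] : exists w, w \in s /\ {subset kills w <= kills u}.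
  apply: contrapT => now.
  have [|p [_ pu ps]] := maximal_kills_separate umax cm cu (s := s).
    by move=> w ws wu; apply: now; exists w.
  exact/pu/(sP u).
apply: (ys w ws); apply/eqP; apply: (smax w ws).2 wu _ _; first exact: umax.1.
by apply: vu; apply/eqP.
Qed.

Lemma depth0_socle : depth m V 0 ->
  exists2 u : V, u <> 0 & forall a, a \in m -> a *: u = 0.
Proof.
move=> [[s [/size0nil-> _ [_ [v Nv]]]] maxV].
have [//|[y ym regy]] := socle_or_regular.
suff /maxV : exists s : seq R,
  [/\ size s = 1%N, {subset s <= m} & regular_seq V s] by [].
exists [:: y]; split=> // [x|]; first by rewrite inE => /eqP->.
split=> [[|//] _ x [z]|].
  by rewrite big_ord0 => /regy->; exists (fun=> 0); rewrite big_ord0.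
(* If yV were all of V, Nakayama would make V zero. *)
apply: contrapT => nosmul; apply: Nv.
have yV (x : V) : exists z, x = y *: z.
  have : in_smul [:: y] x by apply: contrapT => nx; apply: nosmul; exists x.
  by move=> [z ->]; exists (z 0%N); rewrite big_ord1.
have [n [g gV]] := genV.
have /choice[c gc] i : exists c : 'I_n -> R, g i = \sum_j (c j * y) *: g j.
  have [z ->] := yV (g i); have [a ->] := gV z; exists a.
  by rewrite scaler_sumr; apply: eq_bigr => j _; rewrite scalerA mulrC.
have g0 := nakayama (c := fun i j => c i j * y) _ gc.
have [a ->] := gV v; rewrite big1; first by exists (fun=> 0); rewrite big_ord0.
move=> i _; rewrite g0 ?scaler0 // => k j.
by have [m0 _ mP] := local_ideal; rewrite -[_ * _]addr0 mP.
Qed.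

End Socle.
End NoetherianLocal.

(** * Minimal presentations *)

Section LocalPresentation.
Variables (R : comNzRingType) (m : {pred R}).
Hypotheses (noethR : noetherian R) (localR : local_ring m).

Lemma hom_sumE (A B : lmodType R) n (F : 'I_n -> HomR A B) x :
  (\sum_i F i : HomR A B) x = \sum_i F i x.
Proof. exact: (big_morph (fun f : HomR A B => f x)). Qed.

Lemma coordinate n (i : 'I_n) :
  exists c : HomR 'rV[R]_n (R^o : lmodType R), forall x, c x = x 0 i.
Proof.
have [|c cE] := @linear_exists R 'rV[R]_n (R^o : lmodType R) (fun x => x 0 i).
  by move=> a u v; rewrite !mxE.
by exists c.
Qed.

Lemma linear_rowE n (A : lmodType R) (f : {linear 'rV[R]_n -> A}) x :
  f x = \sum_i x 0 i *: f (delta_mx 0 i).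
Proof.
rewrite {1}[x]row_sum_delta linear_sum.
by apply: eq_bigr => i _; rewrite linearZ.
Qed.

(* A submodule W of the dual of R^p that separates the points of (R/m)^p spans
   the dual of (R/m)^p: Gaussian elimination produces elements of W reducing
   to the dual basis. *)
Lemma dual_basis_mod p (W : {pred HomR 'rV[R]_p (R^o : lmodType R)}) :
  submod_closed W ->
  (forall x, (forall w, w \in W -> w x \in m) -> forall j, x 0 j \in m) ->
  exists v : 'I_p -> HomR 'rV[R]_p (R^o : lmodType R), forall i, v i \in W /\
    forall j, v i (delta_mx 0 j) - (i == j)%:R \in m.
Proof.
move=> modW sepW; have [m0 m1 mP] := local_ideal localR.
have [W0 WP] := modW.
pose e j : 'rV[R]_p := delta_mx 0 j.
(* After [k] rounds the first [k] functionals are dual modulo [m] to the first [k] basis vectors;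
   the others are set to 0, so that sums may run over all indices. *)
suff claim k : (k <= p)%N ->
    exists v : 'I_p -> HomR 'rV[R]_p (R^o : lmodType R), forall i,
      [/\ v i \in W, (k <= i)%N -> v i = 0
        & forall j : 'I_p, (j < k)%N -> v i (e j) - (i == j)%:R \in m].
  have [v vP] := claim p (leqnn p); exists v => i.
  by have [vW _ vi] := vP i; split=> // j; apply: vi.
elim: k => [|k IH] lekp; first by exists (fun=> 0).
have [v vP] := IH (ltnW lekp); pose l := Ordinal lekp.
(* With this [x], w(x) is the value at [e l] of w minus the sum of the w(e_i) v_i, a functional with
   values in [m] at the earlier basis vectors. As x_l = 1, separation makes w(x) a unit for some
   w. *)
pose x := e l - \sum_i v i (e l) *: e i.
have xl : x 0 l = 1.
  rewrite /x !mxE !eqxx summxE big1 ?subr0 // => i _; rewrite !mxE /=.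
  have [il|] := eqVneq l i; last by rewrite mulr0.
  by have [_ -> //] := vP i; rewrite -?il ?mul0r.
have [w wW wx] : exists2 w, w \in W & w x \notin m.
  apply: contrapT => now; move/negP: m1; apply; rewrite -xl.
  apply: sepW => w wW; apply: contrapT => /negP wx; apply: now.
  by exists w.
have [c cwx] := local_inv noethR localR wx.
pose w' : HomR 'rV[R]_p (R^o : lmodType R) :=
  c *: (w - \sum_i w (e i) *: v i).
have w'E y : w' y = c * (w y - \sum_i w (e i) * v i y).
  rewrite -[LHS]/(c * (w y - (\sum_i w (e i) *: v i : HomR _ _) y)).
  by rewrite hom_sumE.
have w'W : w' \in W.
  rewrite -[w']addr0; apply: WP => //; apply: submod_sub => //.
  by apply: submod_sum => // i; case: (vP i).
have w'l : w' (e l) = 1.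
  rewrite w'E -[RHS]cwx; congr (c * _).
  rewrite /x (linearB w) (linear_sum w); congr (_ - _).
  by apply: eq_bigr => i _; rewrite linearZ [RHS]mulrC.
have w'j (j : 'I_p) : (j < k)%N -> w' (e j) \in m.
  move=> ltjk; rewrite w'E -[_ * _]addr0; apply: mP => //.
  have -> : w (e j) = \sum_i w (e i) * (i == j)%:R.
    rewrite (bigD1 j) //= eqxx mulr1 big1 ?addr0 // => i /negbTE->.
    by rewrite mulr0.
  rewrite -sumrB; under eq_bigr => i _ do rewrite -mulrBr -opprB mulrN -mulNr.
  apply: (submod_sum (V := R^o) (local_submod localR)) => i.
  by case: (vP i) => _ _; apply.
(* Subtracting the multiple of [w'] clears the value at [e l] and changes the earlier values only by
   elements of [m]. *)
exists (fun i => if i == l then w' else v i - v i (e l) *: w') => i.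
have [->|il] := eqVneq i l.
  split=> // [|j]; first by rewrite ltnn.
  rewrite ltnS leq_eqVlt => /predU1P[jk|ltjk].
    have -> : j = l by apply: val_inj.
    by rewrite eqxx w'l subrr.
  rewrite (_ : l == j = false) ?subr0; first exact: w'j.
  by apply/negbTE; rewrite -val_eqE /= gtn_eqF.
have [viW vi0 vi] := vP i; split=> [|ltki|j].
- by apply: submod_sub => //; rewrite -[_ *: _]addr0; apply: WP.
- by rewrite vi0 ?(ltnW ltki) //= scale0r subrr.
have -> : (v i - v i (e l) *: w' : HomR _ _) (e j) =
  v i (e j) - v i (e l) * w' (e j) by [].
rewrite ltnS leq_eqVlt => /predU1P[jk|ltjk].
  have -> : j = l by apply: val_inj.
  by rewrite w'l mulr1 subrr (negbTE il) subrr.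
rewrite addrAC -mulNr addrC; apply: mP; [exact: w'j | exact: vi].
Qed.

Lemma free_of_bijective_presentation (M : lmodType R) p
    (f : {linear 'rV[R]_p -> M}) :
  (forall y, exists x, f x = y) -> (forall x, f x = 0 -> x = 0) -> is_free M.
Proof.
move=> /choice[s fs] injf.
exists ('I_p : choiceType), (fun i => f (delta_mx 0 i)).
pose e i : M := f (delta_mx 0 i).
pose g y : {freeg 'I_p / R} := \sum_i s y 0 i *: << i >>.
have coeff_sum (a : 'I_p -> R) j :
    coeff j (\sum_i a i *: << i >> : {freeg 'I_p / R}) = a j.
  rewrite raddf_sum (bigD1 j) //= coeff_fgscale coeffU eqxx !mulr1.
  rewrite big1 ?addr0 // => i /negbTE ij.
  by rewrite coeff_fgscale coeffU ij !mulr0.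
have coeffK (D : {freeg 'I_p / R}) : D = \sum_i coeff i D *: << i >>.
  by apply/eqP/freeg_eqP => j; rewrite coeff_sum.
have liftE (a : 'I_p -> R) : fglift e (\sum_i a i *: << i >>) = f (\row_i a i).
  rewrite linear_rowE linear_sum; apply: eq_bigr => i _.
  by rewrite linearZ /= liftU scale1r mxE.
exists g => [D|y]; last first.
  rewrite /g liftE -[RHS]fs; congr (f _).
  by apply/rowP => i; rewrite mxE.
rewrite /g (coeffK D) liftE.
have -> : s (f (\row_i coeff i D)) = \row_i coeff i D.
  by apply/subr0_eq/injf; rewrite linearB fs subrr.
by apply: eq_bigr => i _; rewrite mxE.
Qed.

Section Separation.
Variables (M L : lmodType R) (P : min_presentation m M) (u : L).
Hypotheses (u0 : u <> 0) (mu : forall a, a \in m -> a *: u = 0).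
Hypothesis extTr : ext_vanish (Tr P) (HomR M L) 0.

Lemma dual_separates (x : 'rV[R]_(mp_p P)) :
  (forall w, w \in ker_pred (precomp (R^o : lmodType R) (mp_d P)) ->
    w x \in m) ->
  forall j, x 0 j \in m.
Proof.
move=> wx j; have [_ _ mP] := local_ideal localR.
have [|h hE] := @linear_exists R 'rV[R]_(mp_p P) L (fun b => b 0 j *: u).
  by move=> a b c; rewrite !mxE scalerDl scalerA.
have [||f fE] := linear_factor (p := mp_e P) (h := h); first exact: mp_surj.
  by move=> b /mp_exact[z <-]; rewrite hE mu // mp_min_d.
have mf a y : a \in m -> a *: f y = 0.
  move=> am; have [b <-] := mp_surj P y.
  by rewrite fE hE scalerA mulrC -scalerA mu ?scaler0.
pose Dual q : lmodType R := HomR 'rV[R]_q (R^o : lmodType R).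
(* This [D] is the dual map D^*, whose cokernel is [Tr P]. *)
pose D : {linear Dual (mp_p P) -> Dual (mp_q P)} := precomp _ (mp_d P).
have [|g gE] :=
    @linear_exists R (Dual (mp_p P)) (HomR M L) (fun w => w x *: (f : HomR M L)).
  by move=> a v w; rewrite scalerA -scalerDl.
pose Q := Quotient.quot (submod_pred (im_submod D)).
have [|q qE] := @linear_exists R (Dual (mp_q P)) (Tr P) (\pi_Q : _ -> Q).
  move=> a v w; rewrite raddfD; congr (_ + _).
  exact: (pi_quot_scale (im_submod D)).
have [y||w Dw|g' g'E] := ext_vanish_extend (D := D) (p := q) (h := g) _ _ _ extTr.
- by exists (repr (y : Q)); rewrite qE reprK.
- move=> w; rewrite qE -[RHS](raddf0 \pi_Q).
  split=> [/eqP|[v <-]].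
    by rewrite piE Quotient.equivE subr0 => /asboolP.
  by apply/eqP; rewrite piE Quotient.equivE subr0; apply/asboolP; exists v.
- rewrite gE; apply: linear_ext => y; apply: mf.
  by apply: wx; rewrite inE; apply/eqP.
have /choice[c cE] := @coordinate (mp_p P).
have /choice[c' c'E] := @coordinate (mp_q P).
pose d l := mp_d P (delta_mx 0 l).
have Dc i : D (c i) = \sum_l d l 0 i *: c' l.
  apply: linear_ext => z; rewrite hom_sumE -[LHS]/(c i (mp_d P z)) cE.
  rewrite linear_rowE summxE; apply: eq_bigr => l _.
  by rewrite !mxE -[RHS]/(d l 0 i * c' l z) c'E mulrC.
(* The extension property of [g'] at the i-th coordinate functional, evaluated at the i-th generator
   of M. *)
have xf i : x 0 i *: f (mp_e P (delta_mx 0 i)) =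
    \sum_l d l 0 i *: g' (c' l) (mp_e P (delta_mx 0 i)).
  have := g'E (c i); rewrite gE cE Dc linear_sum => gx.
  rewrite -[LHS]/((x 0 i *: (f : HomR M L)) _) -gx hom_sumE.
  by apply: eq_bigr => l _; rewrite linearZ.
have : f (mp_e P x) = 0.
  rewrite -[LHS]/((f \o mp_e P : {linear _ -> _}) x) linear_rowE.
  under eq_bigr => i _ do rewrite comp_at xf.
  (* With the sum over i taken first, each [l] contributes [g' (c' l)] at the class of the relation
     [d l], which is 0 in M. *)
  rewrite exchange_big big1 // => l _.
  have e0 : mp_e P (d l) = 0 by apply/mp_exact; exists (delta_mx 0 l).
  have := linear_rowE (g' (c' l) \o mp_e P : {linear _ -> _}) (d l).
  by rewrite comp_at e0 linear0.
rewrite fE hE => xu; apply: contrapT => /negP xm.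
have [b bx] := local_inv noethR localR xm.
by apply: u0; rewrite -[u]scale1r -bx -scalerA xu scaler0.
Qed.

(** The dual basis modulo [m] found inside W kills the image of [mp_d P]. Its matrix is the identity
    modulo [m], so the coordinates of a vector in that image are combinations of each other with
    coefficients in [m], and Nakayama applies. *)
Lemma presentation_trivial z : mp_d P z = 0.
Proof.
have modW := ker_submod (precomp (R^o : lmodType R) (mp_d P)).
have [v vP] := dual_basis_mod modW dual_separates.
have vd i : v i (mp_d P z) = 0.
  have [/eqP vi _] := vP i.
  by rewrite -[LHS]/(precomp (R^o : lmodType R) (mp_d P) (v i) z) vi.
pose c i j : R := (i == j)%:R - v i (delta_mx 0 j).
apply/rowP => i; rewrite mxE.
apply: (nakayama (V := R^o) noethR localR (g := fun i => mp_d P z 0 i) (c := c)).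
  move=> j k; rewrite /c -opprB -[- _]add0r.
  apply: (submod_sub (V := R^o) (local_submod localR)).
    by case: (local_ideal localR).
  by case: (vP j).
move=> j; rewrite /c; under eq_bigr => k _ do rewrite scalerBl.
rewrite sumrB -[LHS]subr0; congr (_ - _).
  rewrite (bigD1 j) //= eqxx scale1r big1 ?addr0 // => k.
  by rewrite eq_sym => /negbTE->; rewrite scale0r.
rewrite -[LHS](vd j) linear_rowE.
by apply: eq_bigr => k _; rewrite [LHS]mulrC.
Qed.

End Separation.
End LocalPresentation.

Theorem proposition3p19 (R : comNzRingType) (m : {pred R}) (d : nat)
    (M N : lmodType R) (P : min_presentation m M) :
  cohen_macaulay_local m d ->
  fin_gen M ->
  max_cohen_macaulay m d N ->
  ((1 <= d)%N -> forall i : nat, (1 <= i <= d)%N -> is_zero (Ext M N i)) ->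
  (d = 0%N -> forall i : nat, (0 < i)%N -> is_zero (Ext M N i)) ->
  (forall j : nat, (1 <= j <= d.+1)%N -> is_zero (Ext (Tr P) (HomR M N) j)) ->
  is_free M.
Proof.
move=> [noethR localR _ _] _ [_ genN depthN] extM _ extTr.
(* [ext_vanish] at [i] concerns Ext^(i+1), so [i < d] covers degrees 1 to d and [i <= d] covers
   degrees 1 to d+1. *)
have [i ltid|i leid|L [genL depthL extL]] :=
    ext_vanish_reduction (M := M) (Y := Tr P) genN depthN.
- by apply/is_zero_ext/extM => //; apply: leq_ltn_trans ltid.
- exact/is_zero_ext/extTr.
have [u u0 mu] := depth0_socle noethR localR genL depthL.
apply: (free_of_bijective_presentation (f := mp_e P)); first exact: mp_surj.
by move=> x /mp_exact[z <-]; apply: (presentation_trivial noethR localR u0 mu extL).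
Qed.
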